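(* Let $\Lambda$ be a ring. The full subcategory of the stable category $\Lambda\text{-}\underline{\mathrm{Mod}}$ determined by the torsionfree $\Lambda$-modules is reflective in $\Lambda\text{-}\underline{\mathrm{Mod}}$.
   Context: Rings are associative with identity; modules are left modules. The stable category $\Lambda\text{-}\underline{\mathrm{Mod}}$ has all left $\Lambda$-modules as objects; its morphisms are equivalence classes of $\Lambda$-homomorphisms, where $f$ and $g$ are equivalent if $f-g$ factors through a projective module. For a $\Lambda$-module $A$, write $A^{\ast}=\mathrm{Hom}_\Lambda(A,\Lambda)$; the torsion submodule $t(A)$ is the kernel of the canonical map $A\to A^{\ast\ast}$, equivalently the intersection of the kernels of all homomorphisms $A\to\Lambda$. $A$ is torsionfree if $t(A)=0$. A full subcategory is reflective if its inclusion functor has a left adjoint. *)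

(* Defs.v *)
From HB Require Import structures.
From mathcomp Require Import all_boot all_algebra.
From mathcomp Require Import boolp classical_sets.

Set Implicit Arguments.
Unset Strict Implicit.
Unset Printing Implicit Defensive.

Import GRing.Theory.
Local Open Scope ring_scope.
Local Open Scope quotient_scope.
Local Open Scope classical_set_scope.

Record category := Category {
  obj :> Type;
  hom : obj -> obj -> Type;
  idc : forall a, hom a a;
  compc : forall a b c, hom b c -> hom a b -> hom a c;
  comp1c : forall a b (f : hom a b), compc (idc b) f = f;
  compc1 : forall a b (f : hom a b), compc f (idc a) = f;
  compcA : forall a b c d (h : hom c d) (g : hom b c) (f : hom a b),
    compc h (compc g f) = compc (compc h g) f
}.

Record functor (C D : category) := Functor {
  fobj :> C -> D;
  fmap : forall a b, hom a b -> hom (fobj a) (fobj b);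
  fmap1 : forall a, fmap (idc a) = idc (fobj a);
  fmapM : forall a b c (g : hom b c) (f : hom a b),
    fmap (compc g f) = compc (fmap g) (fmap f)
}.

Definition is_left_adjoint (C D : category)
    (F : functor C D) (G : functor D C) : Prop :=
  exists phi : forall (c : C) (d : D), hom (F c) d -> hom c (G d),
    (forall c d, bijective (@phi c d)) /\
    (forall (c c' : C) (d d' : D)
            (u : hom c' c) (v : hom d d') (k : hom (F c) d),
       phi c' d' (compc v (compc k (fmap F u))) =
       compc (fmap G v) (compc (phi c d k) u)).

Section FullSubcategory.
Variables (C : category) (P : C -> Prop).

Definition full_subcategory : category := {|
  obj := {a : C | P a};
  hom := fun a b => hom (sval a) (sval b);
  idc := fun a => idc (sval a);
  compc := fun a b c => @compc C (sval a) (sval b) (sval c);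
  comp1c := fun a b => @comp1c C (sval a) (sval b);
  compc1 := fun a b => @compc1 C (sval a) (sval b);
  compcA := fun a b c d => @compcA C (sval a) (sval b) (sval c) (sval d)
|}.

Definition inclusion : functor full_subcategory C :=
  @Functor full_subcategory C
    (fun a => sval a) (fun a b f => f)
    (fun a => erefl) (fun a b c g f => erefl).

Definition reflective : Prop :=
  exists L : functor C full_subcategory, is_left_adjoint L inclusion.

End FullSubcategory.

Section Modules.
Variable R : pzRingType.
Implicit Types A B C D M N P Q : lmodType R.

Definition projective P : Prop :=
  forall M N (p : {linear M -> N}) (f : {linear P -> N}),
    (forall y, exists x, p x = y) ->
    exists g : {linear P -> M}, forall x, p (g x) = f x.

Definition factors_through_projective A B (f : {linear A -> B}) : Prop :=
  exists P (h : {linear A -> P}) (k : {linear P -> B}),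
    projective P /\ forall x, f x = k (h x).

Lemma projective_zero : projective 'rV[R]_0.
Proof.
move=> M N p f _; exists (\0 : {linear _ -> _}) => x.
by rewrite (thinmx0 x) !linear0.
Qed.

Lemma projective_prod P Q :
  projective P -> projective Q -> projective (P * Q)%type.
Proof.
move=> pP pQ M N p f psurj.
pose inlP (x : P) : P * Q := (x, 0).
pose inrQ (y : Q) : P * Q := (0, y).
have inlP_lin : linear inlP.
  by move=> a x y; congr pair; rewrite /= scaler0 addr0.
have inrQ_lin : linear inrQ.
  by move=> a x y; congr pair; rewrite /= scaler0 addr0.
pose il : {linear P -> (P * Q)%type} :=
  HB.pack inlP (GRing.isLinear.Build _ _ _ _ inlP inlP_lin).
pose ir : {linear Q -> (P * Q)%type} :=
  HB.pack inrQ (GRing.isLinear.Build _ _ _ _ inrQ inrQ_lin).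
have [g1 Hg1] := pP _ _ p (f \o il : {linear _ -> _}) psurj.
have [g2 Hg2] := pQ _ _ p (f \o ir : {linear _ -> _}) psurj.
exists ((g1 \o fst) \+ (g2 \o snd) : {linear (P * Q)%type -> M}) => -[x y] /=.
rewrite linearD Hg1 Hg2 /= -linearD; congr (f _).
by congr pair; rewrite /= ?addr0 ?add0r.
Qed.

Definition stable_equiv A B (f g : {classic {linear A -> B}}) : bool :=
  `[< factors_through_projective
        ((f : {linear A -> B}) \- (g : {linear A -> B})) >].

Lemma stable_equiv_refl A B : reflexive (@stable_equiv A B).
Proof.
move=> f; apply/asboolP.
exists 'rV[R]_0, (\0 : {linear _ -> _}), (\0 : {linear _ -> _}).
by split=> [|x /=]; [exact: projective_zero | rewrite subrr].
Qed.

Lemma stable_equiv_sym A B : symmetric (@stable_equiv A B).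
Proof.
have sub f g : @stable_equiv A B f g -> stable_equiv g f.
  move=> /asboolP [P [h [k [pP E]]]]; apply/asboolP.
  exists P, h, (\- k : {linear _ -> _}); split=> // x /=.
  by rewrite -E /= opprB.
by move=> f g; apply/idP/idP; exact: sub.
Qed.

Lemma stable_equiv_trans A B : transitive (@stable_equiv A B).
Proof.
move=> g f e /asboolP [P [h [k [pP E]]]] /asboolP [Q [h' [k' [pQ E']]]].
apply/asboolP.
pose hh (x : A) : P * Q := (h x, h' x).
have hh_lin : linear hh by move=> a x y; congr pair; rewrite /= linearP.
pose hl : {linear A -> (P * Q)%type} :=
  HB.pack hh (GRing.isLinear.Build _ _ _ _ hh hh_lin).
exists (P * Q)%type, hl, ((k \o fst) \+ (k' \o snd) : {linear _ -> _}).
split=> [|x]; first exact: projective_prod.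
by rewrite /= -E -E' /= addrA subrK.
Qed.

Canonical stable_equiv_rel A B :=
  EquivRel (@stable_equiv A B) (@stable_equiv_refl A B)
    (@stable_equiv_sym A B) (@stable_equiv_trans A B).

Definition stable_hom A B : Type := {eq_quot (@stable_equiv A B)}.

Definition stable_class A B (f : {linear A -> B}) : stable_hom A B :=
  \pi_({eq_quot (@stable_equiv A B)}) (f : {classic {linear A -> B}}).

Definition stable_repr A B (u : stable_hom A B) : {linear A -> B} :=
  repr (u : {eq_quot (@stable_equiv A B)}).

Lemma stable_reprK A B (u : stable_hom A B) : stable_class (stable_repr u) = u.
Proof. exact: (@reprK _ {eq_quot (@stable_equiv A B)}). Qed.

Lemma stable_classP A B (f g : {linear A -> B}) :
  stable_class f = stable_class g <->
  factors_through_projective (f \- g : {linear A -> B}).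
Proof.
split=> [/eqmodP/asboolP //|fg].
by apply/eqmodP/asboolP.
Qed.

Lemma eq_stable_class A B (f g : {linear A -> B}) :
  f =1 g -> stable_class f = stable_class g.
Proof.
move=> fg; apply/stable_classP.
exists 'rV[R]_0, (\0 : {linear _ -> _}), (\0 : {linear _ -> _}).
by split=> [|x /=]; [exact: projective_zero | rewrite fg subrr].
Qed.

Definition stable_id A : stable_hom A A :=
  stable_class (idfun : {linear A -> A}).

Definition stable_comp A B C (v : stable_hom B C) (u : stable_hom A B) :
    stable_hom A C :=
  stable_class (stable_repr v \o stable_repr u : {linear A -> C}).

Lemma stable_compE A B C (g : {linear B -> C}) (f : {linear A -> B}) :
  stable_comp (stable_class g) (stable_class f) =
  stable_class (g \o f : {linear A -> C}).
Proof.
rewrite /stable_comp.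
have /stable_classP [P [h [k [pP E]]]] := stable_reprK (stable_class g).
have /stable_classP [Q [h' [k' [pQ E']]]] := stable_reprK (stable_class f).
set g' := stable_repr _ in E *; set f' := stable_repr _ in E' *.
transitivity (stable_class (g \o f' : {linear A -> C})); apply/stable_classP.
  by exists P, (h \o f' : {linear _ -> _}), k; split=> // x /=; rewrite -E.
exists Q, h', (g \o k' : {linear _ -> _}); split=> // x /=.
by rewrite -E' /= linearB.
Qed.

Lemma stable_comp1 A B (u : stable_hom A B) : stable_comp (stable_id B) u = u.
Proof.
by rewrite -(stable_reprK u) stable_compE; exact: eq_stable_class.
Qed.

Lemma stable_compr1 A B (u : stable_hom A B) : stable_comp u (stable_id A) = u.
Proof.
by rewrite -(stable_reprK u) stable_compE; exact: eq_stable_class.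
Qed.

Lemma stable_compA A B C D (w : stable_hom C D) (v : stable_hom B C)
    (u : stable_hom A B) :
  stable_comp w (stable_comp v u) = stable_comp (stable_comp w v) u.
Proof.
rewrite -(stable_reprK u) -(stable_reprK v) -(stable_reprK w) !stable_compE.
exact: eq_stable_class.
Qed.

Definition stable_category : category := {|
  obj := lmodType R;
  hom := stable_hom;
  idc := stable_id;
  compc := stable_comp;
  comp1c := stable_comp1;
  compc1 := stable_compr1;
  compcA := stable_compA
|}.

(** The kernel of the evaluation map from [A] to its bidual, written as the
    intersection of the kernels of the linear forms on [A]. *)
Definition torsion A : set A :=
  [set x | forall f : {linear A -> R^o}, f x = 0].

Definition torsionfree A : Prop := @torsion A = [set 0].

End Modules.

(* Main.v *)
From mathcomp Require Import all_boot all_algebra.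
From HB Require Import structures.
From mathcomp Require Import boolp classical_sets functions cardinality fsbigop.
Require Import Defs.

(** The reflection of [A] is [A -> A / t(A)], with [A / t(A)] realized as the
    image of [A] in its bidual.  Linear maps to torsionfree modules extend
    uniquely along it.  That the extension respects stable equivalence holds
    because projective modules embed in free ones and are therefore
    torsionfree: if [g \o eta] factors as [A -> P -> B] with [P] projective,
    then [A -> P] itself extends along [eta], so [g] factors through [P]. *)

Set Implicit Arguments.
Unset Strict Implicit.
Unset Printing Implicit Defensive.

Import GRing.Theory.
Local Open Scope ring_scope.
Local Open Scope classical_set_scope.

(** Universal arrows assemble into a left adjoint: [L f] is the unique map extending
    [compc (eta d) f] along [eta c]. Uniqueness gives the functor laws, and precomposition with
    [eta c] is the adjunction bijection. *)
Lemma reflective_universal_arrow (C : category) (P : C -> Prop) :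
  (forall c : C, exists (r : C) (eta : hom c r), P r /\
     forall d : C, P d -> bijective (fun k : hom r d => compc k eta)) ->
  reflective P.
Proof.
move=> univ.
pose r c := sval (cid (univ c)).
pose eta c : hom c (r c) := sval (cid (svalP (cid (univ c)))).
have Pr c : P (r c) by have [] := svalP (cid (svalP (cid (univ c)))).
have eta_bij c d : P d -> bijective (fun k : hom (r c) d => compc k (eta c)).
  by have [_] := svalP (cid (svalP (cid (univ c)))); apply.
have ext c d (f : hom c d) : P d -> {k | compc k (eta c) = f}.
  move=> Pd; apply: cid; have [k _ kK] := eta_bij c d Pd.
  by exists (k f); rewrite kK.
pose Lmap c d (f : hom c d) : hom (r c) (r d) :=
  sval (ext _ _ (compc (eta d) f) (Pr d)).
have LmapE c d (f : hom c d) : compc (Lmap c d f) (eta c) = compc (eta d) f.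
  exact: svalP (ext _ _ (compc (eta d) f) (Pr d)).
have Lmap1 c : Lmap c c (idc c) = idc (r c).
  by apply: (bij_inj (eta_bij c _ (Pr c))); rewrite /= LmapE compc1 comp1c.
have LmapM a b c (g : hom b c) (f : hom a b) :
    Lmap a c (compc g f) = compc (Lmap b c g) (Lmap a b f).
  apply: (bij_inj (eta_bij a _ (Pr c))) => /=.
  by rewrite LmapE -compcA LmapE !compcA LmapE.
exists (@Functor C (full_subcategory P) (fun c => exist P (r c) (Pr c))
  Lmap Lmap1 LmapM).
exists (fun c d (k : hom (r c) (sval d)) => compc k (eta c)); split.
  by move=> c d; exact: eta_bij (svalP d).
by move=> c c' d d' u v k /=; rewrite -!compcA LmapE.
Qed.

Section Submodule.
Variables (R : pzRingType) (V : lmodType R) (S : submodClosed V).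

Record submodule := Submodule { submodule_val :> V; _ : submodule_val \in S }.

HB.instance Definition _ := [isSub for submodule_val].
HB.instance Definition _ := [Choice of submodule by <:].
HB.instance Definition _ := [SubChoice_isSubLmodule of submodule by <:].

End Submodule.

Section Modules.
Variable R : pzRingType.
Implicit Types A B M P : lmodType R.

Lemma linear_factor A M B (p : {linear A -> M}) (f : {linear A -> B}) :
    (forall y, exists x, p x = y) -> (forall x, p x = 0 -> f x = 0) ->
  exists g : {linear M -> B}, forall x, g (p x) = f x.
Proof.
move=> psurj kerpf.
pose s y := sval (cid (psurj y)).
have sK y : p (s y) = y := svalP (cid (psurj y)).
have fs x : f (s (p x)) = f x.
  by apply/eqP; rewrite -subr_eq0 -linearB kerpf// linearB /= sK subrr.
(* The section [s] may fail to be linear, but by [fs] the value of [f] depends only on the image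
   under [p], and both sides have the same image. *)
have g_lin : linear (f \o s).
  by move=> a x y /=; rewrite -linearP -[LHS]fs -[RHS]fs !linearP !sK.
exists (HB.pack (f \o s) (GRing.isLinear.Build _ _ _ _ _ g_lin)
  : {linear M -> B}); exact: fs.
Qed.

Lemma torsionfreeP A :
  torsionfree A <->
  forall x : A, (forall f : {linear A -> R^o}, f x = 0) -> x = 0.
Proof.
split=> [tA x xt|tA].
  by have : [set 0] x by rewrite -tA.
apply/seteqP; split=> [x|x ->]; first exact: tA.
by move=> f; rewrite linear0.
Qed.

Lemma torsionfree_mono A B (i : {linear A -> B}) :
  injective i -> torsionfree B -> torsionfree A.
Proof.
move=> i_inj /torsionfreeP tB; apply/torsionfreeP => x xt.
by apply: i_inj; rewrite linear0; apply: tB => f; exact: (xt (f \o i)).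
Qed.

(** Evaluations at the points of [T] are linear forms, and they separate functions. *)
Lemma torsionfree_fun (T : Type) : torsionfree (T -> R^o).
Proof.
apply/torsionfreeP => x xt; apply/funext => t.
have ev_lin : linear (fun f : T -> R^o => f t) by [].
exact: (xt (HB.pack (fun f : T -> R^o => f t)
  (GRing.isLinear.Build _ _ _ _ _ ev_lin))).
Qed.

Lemma torsionfree_submodule_fun (T : Type) (S : submodClosed (T -> R^o)) :
  torsionfree (submodule S).
Proof.
exact: (@torsionfree_mono _ _ (val : {linear submodule S -> (T -> R^o)})
  val_inj (@torsionfree_fun T)).
Qed.

Section Free.
Variable T : choiceType.

(** The free module on [T] is carved out of [T -> R^o], from which it inherits torsionfreeness. *)
Definition finsupp_fun : {pred T -> R^o} :=
  [pred f | `[< finite_set (f @^-1` [set~ 0]) >]].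

Lemma finsupp_fun_submod_closed : submod_closed finsupp_fun.
Proof.
split=> [|a f g /asboolP fin_f /asboolP fin_g]; apply/asboolP.
  by apply: (sub_finite_set _ (finite_set0 T)) => x /(_ erefl).
apply: (@sub_finite_set _ _ (f @^-1` [set~ 0] `|` g @^-1` [set~ 0])); last first.
  by rewrite finite_setU.
move=> x /= fgx; apply: contrapT => /not_orP[/contrapT fx /contrapT gx].
by apply: fgx; rewrite !fctE /= fx gx scaler0 addr0.
Qed.

HB.instance Definition _ :=
  GRing.isSubmodClosed.Build R (T -> R^o) finsupp_fun finsupp_fun_submod_closed.

Definition free_module : lmodType R := submodule finsupp_fun.

End Free.

Section FreeCover.
Variable A : lmodType R.

Definition free_cover_fun (f : free_module A) : A :=
  \sum_(x \in [set: A]) (val f x : R) *: x.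

(** Enlarging the support adds only zero terms, so sums for several functions can be taken over one
    common finite set. *)
Lemma free_cover_funE (D : set A) (f : free_module A) :
  finite_set D -> val f @^-1` [set~ 0] `<=` D ->
  free_cover_fun f = \sum_(x \in D) (val f x : R) *: x.
Proof.
move=> Dfin fD; apply/esym/fsbig_widen => // x [_ Dx] /=.
suff -> : val f x = 0 by rewrite scale0r.
by apply: contrapT => fx; exact/Dx/fD.
Qed.

Lemma free_cover_fun_linear : linear free_cover_fun.
Proof.
move=> a f g.
have /asboolP fin_f := valP f; have /asboolP fin_g := valP g.
have /asboolP fin_h := valP (a *: f + g).
(* A common finite index set for the three sums, with the support of [a *: f + g] included
   outright. *)
pose D := (val f @^-1` [set~ 0] `|` val g @^-1` [set~ 0])
  `|` val (a *: f + g) @^-1` [set~ 0].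
have Dfin : finite_set D by rewrite !finite_setU.
rewrite !(free_cover_funE Dfin); try by move=> x; rewrite /D /=; tauto.
rewrite !fsbig_finite// scaler_sumr -big_split; apply: eq_bigr => x _ /=.
by rewrite scalerA -scalerDl.
Qed.

HB.instance Definition _ :=
  GRing.isLinear.Build _ _ _ _ free_cover_fun free_cover_fun_linear.

Definition free_cover : {linear free_module A -> A} := free_cover_fun.

Lemma free_cover_surj (x : A) : exists f, free_cover f = x.
Proof.
pose d (y : A) : R^o := if y == x then 1 else 0.
have dP : d \in @finsupp_fun A.
  apply/asboolP/(sub_finite_set _ (finite_set1 x)) => y /=.
  by rewrite /d; case: eqP.
exists (Submodule dP); rewrite /free_cover /= (@free_cover_funE [set x])//.
  by rewrite fsbig_set1 /= /d eqxx scale1r.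
by move=> y /=; rewrite /d; case: eqP.
Qed.

End FreeCover.

(** Lifting the identity through the free cover splits it, so [P] embeds in a module of
    functions. *)
Lemma projective_torsionfree P : projective P -> torsionfree P.
Proof.
move=> /(_ _ _ (free_cover P) idfun (@free_cover_surj P))[i iK].
by apply: (torsionfree_mono (can_inj iK)); exact: torsionfree_submodule_fun.
Qed.

Section Reflection.
Variable A : lmodType R.

(** The image of [A] in its bidual, viewed inside all functions on the dual, so that torsionfreeness
    comes from [torsionfree_fun]. *)
Definition evaluation_fun : {pred {linear A -> R^o} -> R^o} :=
  [pred phi | `[< exists x : A, phi = fun f : {linear A -> R^o} => f x >]].

Lemma evaluation_fun_submod_closed : submod_closed evaluation_fun.
Proof.
split=> [|a _ _ /asboolP[x ->] /asboolP[y ->]]; apply/asboolP.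
  by exists 0; apply/funext => f; rewrite linear0.
by exists (a *: x + y); apply/funext => f; rewrite linearP.
Qed.

HB.instance Definition _ :=
  GRing.isSubmodClosed.Build R ({linear A -> R^o} -> R^o)
    evaluation_fun evaluation_fun_submod_closed.

Definition torsionless_quotient : lmodType R := submodule evaluation_fun.

Lemma evaluation_subproof (x : A) :
  (fun f : {linear A -> R^o} => f x) \in evaluation_fun.
Proof. by apply/asboolP; exists x. Qed.

Definition evaluation (x : A) : torsionless_quotient :=
  Submodule (evaluation_subproof x).

Lemma evaluation_linear : linear evaluation.
Proof.
by move=> a x y; apply/val_inj/funext => f; rewrite /= linearP.
Qed.

HB.instance Definition _ :=
  GRing.isLinear.Build _ _ _ _ evaluation evaluation_linear.

Lemma evaluation_surj y : exists x, evaluation x = y.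
Proof.
by have /asboolP[x xE] := valP y; exists x; apply: val_inj; rewrite /= -xE.
Qed.

(** If [x] is killed by every form on [A], then each form [h] on [B] kills [f x], because [h \o f]
    is a form on [A]; torsionfreeness of [B] gives [f x = 0]. *)
Lemma evaluation_extend B (f : {linear A -> B}) : torsionfree B ->
  exists g : {linear torsionless_quotient -> B},
    forall x, g (evaluation x) = f x.
Proof.
move=> /torsionfreeP tB; apply: linear_factor evaluation_surj _ => x x0.
apply: tB => h.
exact: (congr1 (fun y : torsionless_quotient => val y (h \o f)) x0).
Qed.

Lemma stable_evaluation_bij B : torsionfree B ->
  bijective (fun k : stable_hom torsionless_quotient B =>
               stable_comp k (stable_class evaluation)).
Proof.
move=> tB.
have inj : injective (fun k : stable_hom torsionless_quotient B =>
               stable_comp k (stable_class evaluation)).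
  move=> u v /=; rewrite -(stable_reprK u) -(stable_reprK v) !stable_compE.
  move=> /stable_classP[P [h [k [pP hk]]]]; apply/stable_classP.
  have [g gE] := evaluation_extend h (projective_torsionfree pP).
  exists P, g, k; split=> // y; have [x <-] := evaluation_surj y.
  by rewrite gE -hk.
(* Surjectivity already holds for linear maps: a representative of [u] extends along [evaluation] on
   the nose. *)
have surj (u : stable_hom A B) : {k : stable_hom torsionless_quotient B |
    stable_comp k (stable_class evaluation) = u}.
  apply: cid; have [g gE] := evaluation_extend (stable_repr u) tB.
  exists (stable_class g); rewrite stable_compE -[RHS]stable_reprK.
  exact: eq_stable_class.
exists (fun u => sval (surj u)) => [k|u]; last exact: svalP (surj u).
by apply: inj; exact: svalP (surj _).
Qed.

End Reflection.

End Modules.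

Theorem corollary6p15 (Lambda : pzRingType) :
  @reflective (stable_category Lambda) (@torsionfree Lambda).
Proof.
apply: reflective_universal_arrow => A.
exists (torsionless_quotient A), (stable_class (@evaluation Lambda A)).
split; first exact: torsionfree_submodule_fun.
by move=> B; exact: stable_evaluation_bij.
Qed.
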